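(* Let $M$ and $N$ be two quasianalytic weight sequences such that $\sup_{k\in\mathbb N_{>0}}n_k^{1/k}=+\infty$ (Roumieu case) resp. $\lim_{k\to+\infty}n_k^{1/k}=+\infty$ (Beurling case), i.e. $\mathcal O^{0,r}\subsetneq\mathcal E^{0,r}_{\{N\}}$ resp. $\mathcal O^{0,r}\subsetneq\mathcal E^{0,r}_{(N)}$. Then $j^\infty(\mathcal E^{0,r}_{\{M\}})\cap\Lambda^r_{[N]}\subsetneq\Lambda^r_{[N]}$ (and hence also $j^\infty(\mathcal E^{0,r}_{(M)})\cap\Lambda^r_{[N]}\subsetneq\Lambda^r_{[N]}$). In particular the Borel map $j^\infty:\mathcal E^{0,r}_{[N]}\to\Lambda^r_{[N]}$ is not surjective.
   Context: For a sequence $M=(M_p)_{p\in\mathbb N}$ of positive reals write $m_p:=M_p/p!$ (and $n_p:=N_p/p!$). $M$ is a weight sequence if $1=M_0\le M_1$, $M_p^2\le M_{p-1}M_{p+1}$ for all $p\ge1$, and $\liminf_{p\to\infty}m_p^{1/p}>0$; it is quasianalytic if $\sum_{p\ge1}M_{p-1}/M_p=+\infty$. For $U\subseteq\mathbb R^r$ open, $K\subseteq U$ compact, $h>0$: $\|f\|^M_{K,h}:=\sup_{\alpha\in\mathbb N^r,x\in K}|\partial^\alpha f(x)|/(h^{|\alpha|}M_{|\alpha|})$. $\mathcal E_{\{M\}}(U)$ (Roumieu) consists of smooth $f$ such that for every compact $K\subseteq U$ there exists $h>0$ with $\|f\|^M_{K,h}<\infty$; $\mathcal E_{(M)}(U)$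 (Beurling): for every compact $K$ and every $h>0$. $\mathcal E^{0,r}_{\{M\}}$, $\mathcal E^{0,r}_{(M)}$ are the spaces of germs at $0\in\mathbb R^r$ of functions in the respective class on some cube $(-1/k,1/k)^r$; $\mathcal O^{0,r}$ is the space of germs at $0$ of real analytic functions. For $\mathbf b=(b_\alpha)_{\alpha\in\mathbb N^r}$ and $h>0$: $|\mathbf b|^N_h:=\sup_\alpha|b_\alpha|/(h^{|\alpha|}n_{|\alpha|})$; $\Lambda^r_{\{N\}}:=\{\mathbf b:\exists h>0,|\mathbf b|^N_h<\infty\}$, $\Lambda^r_{(N)}:=\{\mathbf b:\forall h>0,|\mathbf b|^N_h<\infty\}$. The Borel map is $j^\infty(f)=(\partial^\alpha f(0)/|\alpha|!)_{\alpha\in\mathbb N^r}$. The notation $[\cdot]$ means either $\{\cdot\}$ throughout (Roumieu) or $(\cdot)$ throughout (Beurling). *)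

(* Defs.v *)
From Stdlib Require Import Reals List.
From mathcomp Require Import all_boot.


Local Open Scope R_scope.

Definition pt (r : nat) := 'I_r -> R.
Definition mindex (r : nat) := 'I_r -> nat.

Definition mlen (r : nat) (a : mindex r) : nat := (\sum_(i < r) a i)%N.

Definition mzero (r : nat) : mindex r := fun _ => 0%N.
Definition pzero (r : nat) : pt r := fun _ => 0.

Definition mincr (r : nat) (a : mindex r) (i : 'I_r) : mindex r :=
  fun j => if j == i then (a j).+1 else a j.

Definition pupd (r : nat) (x : pt r) (i : 'I_r) (t : R) : pt r :=
  fun j => if j == i then t else x j.

Definition near_pt (r : nat) (d : R) (x y : pt r) : Prop :=
  forall i, Rabs (y i - x i) < d.

Definition open_set (r : nat) (S : pt r -> Prop) : Prop :=
  forall x, S x -> exists d, 0 < d /\ forall y, near_pt r d x y -> S y.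

Definition compact_set (r : nat) (K : pt r -> Prop) : Prop :=
  forall (I : Type) (O : I -> pt r -> Prop),
    (forall i, open_set r (O i)) ->
    (forall x, K x -> exists i, O i x) ->
    exists l : list I, forall x, K x -> exists i, In i l /\ O i x.

(** the cube (-1/k, 1/k)^r, k >= 1 (written with k.+1 for k : nat) *)
Definition cube (r k : nat) : pt r -> Prop :=
  fun x => forall i, Rabs (x i) < / INR k.+1.

(** D is the family of all partial derivatives (D alpha = ∂^alpha f) of a
    C^infinity function f on the open set U: D 0 = f, every D alpha is
    continuous on U, and ∂_i (D alpha) = D (alpha + e_i) on U.
    (On an open set such a family is unique.) *)
Definition deriv_family (r : nat) (U : pt r -> Prop) (f : pt r -> R)
    (D : mindex r -> pt r -> R) : Prop :=
  (forall x, U x -> D (mzero r) x = f x) /\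
  (forall a x, U x -> forall eps, 0 < eps -> exists d, 0 < d /\
      forall y, U y -> near_pt r d x y -> Rabs (D a y - D a x) < eps) /\
  (forall a i x, U x ->
      derivable_pt_lim (fun t => D a (pupd r x i t)) (x i) (D (mincr r a i) x)).

Definition mseq (M : nat -> R) (p : nat) : R := M p / INR (p`!)%N.

Definition root_m (M : nat -> R) (p : nat) : R := Rpower (mseq M p) (/ INR p).

Definition weight_sequence (M : nat -> R) : Prop :=
  (forall p, 0 < M p) /\
  M 0%N = 1 /\ M 0%N <= M 1%N /\
  (forall p, (1 <= p)%N -> M p ^ 2 <= M (p - 1)%N * M (p + 1)%N) /\
  (exists c, 0 < c /\ exists P, forall p, (P <= p)%N -> (1 <= p)%N ->
      c <= root_m M p).

(** sum_{p >= 1} M_{p-1}/M_p = +oo (positive terms: partial sums unbounded) *)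
Definition quasianalytic (M : nat -> R) : Prop :=
  forall B, exists n, B < sum_f_R0 (fun p => M p / M (p + 1)%N) n.

(** growth hypothesis on N:
    Roumieu (c = true):  sup_{k>0} n_k^{1/k} = +oo
    Beurling (c = false): lim_{k->oo} n_k^{1/k} = +oo *)
Definition growth (c : bool) (N : nat -> R) : Prop :=
  if c then forall B, exists k, (1 <= k)%N /\ B < root_m N k
  else forall B, exists K, forall k, (K <= k)%N -> (1 <= k)%N -> B < root_m N k.

Definition seminorm_finite (r : nat) (M : nat -> R) (K : pt r -> Prop)
    (h : R) (D : mindex r -> pt r -> R) : Prop :=
  exists C, forall a x, K x -> Rabs (D a x) <= C * (h ^ mlen r a * M (mlen r a)).

Definition in_class (c : bool) (r : nat) (M : nat -> R) (U : pt r -> Prop)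
    (f : pt r -> R) (D : mindex r -> pt r -> R) : Prop :=
  deriv_family r U f D /\
  forall K, compact_set r K -> (forall x, K x -> U x) ->
    if c then exists h, 0 < h /\ seminorm_finite r M K h D
    else forall h, 0 < h -> seminorm_finite r M K h D.

Definition jet (r : nat) (D : mindex r -> pt r -> R) : mindex r -> R :=
  fun a => D a (pzero r) / INR ((mlen r a)`!)%N.

(** b \in j^oo(E^{0,r}_{[M]}): b is the jet of (a representative of) a germ
    at 0 of a function of class [M] on some cube (-1/k,1/k)^r. *)
Definition in_jet_image (c : bool) (r : nat) (M : nat -> R)
    (b : mindex r -> R) : Prop :=
  exists k f D, in_class c r M (cube r k) f D /\ b = jet r D.

Definition seqnorm_finite (r : nat) (N : nat -> R) (h : R) (b : mindex r -> R)
  : Prop :=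
  exists C, forall a, Rabs (b a) <= C * (h ^ mlen r a * mseq N (mlen r a)).

Definition in_Lambda (c : bool) (r : nat) (N : nat -> R) (b : mindex r -> R)
  : Prop :=
  if c then exists h, 0 < h /\ seqnorm_finite r N h b
  else forall h, 0 < h -> seqnorm_finite r N h b.

(* Main.v *)
Require Import Defs.
From Stdlib Require Import Reals List Lra Ranalysis5 Classical FunctionalExtensionality.
From mathcomp Require Import all_boot.
From mathcomp Require Import zify_ssreflect.

Local Open Scope R_scope.

(** The witness is [b_a = sqrt n_{|a|}], which lies in Lambda_[N] and grows faster than
    any geometric sequence. If it were the jet of a germ of class {M}, the restriction [g]
    of that germ to a coordinate axis would have all its derivatives positive at 0.
    Following Bang, all derivatives of [g] are then nonnegative on some [0, d]: otherwise
    Rolle's theorem yields zeros [y_k > y_{k+1} > ... > 0] of [g^(k), g^(k+1), ...], and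
    the jet of [g], measured by [sup_j |g^(j)| / (e^j M_j)], grows so slowly along
    the path from [y_K] up to [y_k] and back down to 0 that divergence of
    [sum M_{p-1} / M_p] forces [g^(k)(0) = 0]. Nonnegativity of the derivatives makes each
    Taylor term [b_n d^n] at most [g(d)], which contradicts the growth of [b]. *)

(** * Elementary calculus *)

Lemma exp_le_compat (x y : R) : x <= y -> exp x <= exp y.
Proof. by case=> [/exp_increasing/Rlt_le|->]; [|exact: Rle_refl]. Qed.

Lemma nondecreasing_of_derive (F F' : R -> R) (a b : R) :
  a <= b ->
  (forall t, a <= t <= b -> derivable_pt_lim F t (F' t)) ->
  (forall t, a <= t <= b -> 0 <= F' t) -> F a <= F b.
Proof.
move=> [ab|->] dF F'0; last by apply: Rle_refl.
have [c [E [c1 c2]]] := MVT_cor2 F F' a b ab dF.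
have F'c : 0 <= F' c by apply: F'0; lra.
have : 0 <= F' c * (b - a) by apply: Rmult_le_pos => //; lra.
lra.
Qed.

Lemma derivable_pt_lim_affine (f : R -> R) (x s t l : R) :
  derivable_pt_lim f (x + s * t) l ->
  derivable_pt_lim (fun u => f (x + s * u)) t (s * l).
Proof.
move=> df; rewrite Rmult_comm.
apply: (derivable_pt_lim_comp (fun u => x + s * u) f) => //.
rewrite -[X in derivable_pt_lim _ _ X]Rplus_0_l.
apply: derivable_pt_lim_plus; first exact: derivable_pt_lim_const.
by rewrite -{2}[s]Rmult_1_r; apply: derivable_pt_lim_scal; apply: derivable_pt_lim_id.
Qed.

Lemma derivable_pt_lim_scal_exp (A k t : R) :
  derivable_pt_lim (fun u => A * exp (k * u)) t (A * (k * exp (k * t))).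
Proof.
apply: derivable_pt_lim_scal.
apply: (derivable_pt_lim_ext (fun u => exp (0 + k * u))).
  by move=> u; rewrite Rplus_0_l.
apply: derivable_pt_lim_affine; rewrite Rplus_0_l; exact: derivable_pt_lim_exp.
Qed.

(** * Bang's argument on an interval [0, d] *)

Section Bang.

Variables (L : nat -> R) (g : nat -> R -> R) (d : R).
Hypothesis L_gt0 : forall p, 0 < L p.
Hypothesis L_logconvex : forall p, L p.+1 ^ 2 <= L p * L p.+2.
Hypothesis g_derive : forall n t, 0 <= t <= d -> derivable_pt_lim (g n) t (g n.+1 t).
Hypothesis g_bound : forall n t, 0 <= t <= d -> Rabs (g n t) <= L n.

(** Length over which an exponential of rate [/ cost i] gains a factor e. For L_p = A h^p M_p the
    sum of the costs diverges exactly when M is quasianalytic. *)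
Definition cost (i : nat) : R := L i / (exp 1 * L i.+1).

Lemma cost_gt0 (i : nat) : 0 < cost i.
Proof.
apply: Rdiv_lt_0_compat => //; apply: Rmult_lt_0_compat => //; exact: exp_pos.
Qed.

(** Log-convexity makes L_{p+1} / L_p nondecreasing; the inequality is cross-multiplied. *)
Lemma ratio_mono (j N : nat) : (j <= N)%N -> L j.+1 * L N <= L N.+1 * L j.
Proof.
elim: N => [|N IH]; first by rewrite leqn0 => /eqP ->; lra.
rewrite leq_eqVlt => /orP [/eqP ->|]; first by lra.
rewrite ltnS => /IH {}IH.
have a1 := L_gt0 N; have a2 := L_gt0 N.+1; have a3 := L_gt0 N.+2.
have a4 := L_gt0 j; have a5 := L_gt0 j.+1; have lc := L_logconvex N.
apply: (Rmult_le_reg_l (L N)) => //.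
apply: (Rle_trans _ (L j * (L N.+1 ^ 2))).
  have := Rmult_le_compat_r (L N.+1) _ _ (Rlt_le _ _ a2) IH; nra.
have := Rmult_le_compat_l (L j) _ _ (Rlt_le _ _ a4) lc; lra.
Qed.

(** Bang's jet norm, cut off below order n so that a zero of [g n] can lower the cutoff. *)
Definition small_jet (n : nat) (x beta : R) : Prop :=
  forall j, (n <= j)%N -> Rabs (g j x) <= beta * (exp (INR j) * L j).

Lemma small_jet_trivial (n : nat) (x beta : R) :
  0 <= x <= d -> exp (- INR n) <= beta -> small_jet n x beta.
Proof.
move=> xd nb j nj; apply: (Rle_trans _ (L j)); first exact: g_bound.
have Lj := L_gt0 j; have e0 := exp_pos (INR j).
rewrite -Rmult_assoc -{1}[L j]Rmult_1_l; apply: Rmult_le_compat_r; first by lra.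
apply: (Rle_trans _ (exp (- INR n) * exp (INR j))); last by apply: Rmult_le_compat_r; lra.
rewrite -exp_plus -exp_0; apply: exp_le_compat.
have : INR n <= INR j by apply: le_INR; lia.
lra.
Qed.

(** Descending induction on the order j. Orders above N satisfy the bound everywhere, because beta
    is at least exp (- (N + 1)); for j <= N the bound on order j + 1 is integrated from x. *)
Lemma small_jet_move (n N : nat) (x s h beta : R) :
  s = 1 \/ s = - 1 -> 0 <= h -> 0 <= x <= d -> 0 <= x + s * h <= d ->
  exp (- INR N.+1) <= beta -> small_jet n x beta ->
  small_jet n (x + s * h) (beta * exp (/ cost N * h)).
Proof.
move=> s1 h0 xd xhd Nb small.
have b0 : 0 < beta by apply: Rlt_le_trans Nb; exact: exp_pos.
have cN := cost_gt0 N.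
have inseg t : 0 <= t <= h -> 0 <= x + s * t <= d by case: s1 xhd => -> ? ?; lra.
(* The counter m bounds N + 1 - j, which turns the descent in j into an induction. *)
suff key m j : (n <= j)%N -> (N.+1 - j <= m)%N -> forall t, 0 <= t <= h ->
    Rabs (g j (x + s * t)) <= beta * (exp (INR j) * L j) * exp (/ cost N * t).
  move=> j nj; have := key _ j nj (leqnn _) h (conj h0 (Rle_refl h)); lra.
elim: m j => [|m IH] j nj jm t t0h.
  have Nj : (N.+1 <= j)%N by lia.
  have := small_jet_trivial N.+1 _ beta (inseg t t0h) Nb j Nj => H.
  apply: Rle_trans H _.
  have e1 : 1 <= exp (/ cost N * t).
    rewrite -exp_0; apply: exp_le_compat; apply: Rmult_le_pos; last by lra.
    by apply: Rlt_le; apply: Rinv_0_lt_compat.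
  have Lj : 0 < beta * (exp (INR j) * L j).
    by apply: Rmult_lt_0_compat => //; apply: Rmult_lt_0_compat; [exact: exp_pos|exact: L_gt0].
  by rewrite -[X in X <= _]Rmult_1_r; apply: Rmult_le_compat_l; lra.
have [Nj|jN] := leqP N.+1 j; first by apply: IH => //; lia.
set A := beta * (exp (INR j) * L j).
have A0 : 0 < A.
  by apply: Rmult_lt_0_compat => //; apply: Rmult_lt_0_compat; [exact: exp_pos|exact: L_gt0].
(* The slope of the exponential majorant dominates the majorant of [g j.+1]. *)
have slope : beta * (exp (INR j.+1) * L j.+1) <= A * / cost N.
  rewrite /A /cost S_INR exp_plus.
  have a1 := L_gt0 N; have a2 := L_gt0 N.+1; have e1 := exp_pos 1.
  have rm := ratio_mono j N jN.
  have -> : beta * (exp (INR j) * L j) * / (L N / (exp 1 * L N.+1)) =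
     beta * exp (INR j) * exp 1 * (L N.+1 * L j / L N) by field; lra.
  have -> : beta * (exp (INR j) * exp 1 * L j.+1) =
     beta * exp (INR j) * exp 1 * (L j.+1 * L N / L N) by field; lra.
  apply: Rmult_le_compat_l.
    have := exp_pos (INR j) => ej.
    by apply: Rlt_le; do 2 apply: Rmult_lt_0_compat => //.
  by apply: Rmult_le_compat_r rm; apply: Rlt_le; apply: Rinv_0_lt_compat.
(* The two signs [sg] give the two halves of the absolute value; [s] is the direction of travel. *)
have signed sg : sg = 1 \/ sg = - 1 -> sg * g j (x + s * t) <= A * exp (/ cost N * t).
  move=> sg1.
  have := nondecreasing_of_derive
    (fun u => A * exp (/ cost N * u) - sg * g j (x + s * u))
    (fun u => A * (/ cost N * exp (/ cost N * u)) - sg * (s * g j.+1 (x + s * u)))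
    0 t (proj1 t0h).
  rewrite !Rmult_0_r exp_0 Rplus_0_r Rmult_1_r => H.
  have start : Rabs (g j x) <= A by apply: small.
  have sx : sg * g j x <= A.
    by move: start; rewrite /Rabs; case: Rcase_abs; case: sg1 => ->; lra.
  suff : A - sg * g j x <= A * exp (/ cost N * t) - sg * g j (x + s * t) by lra.
  apply: H => u ut.
    apply: derivable_pt_lim_minus; first exact: derivable_pt_lim_scal_exp.
    apply: derivable_pt_lim_scal; apply: derivable_pt_lim_affine; apply: g_derive.
    by apply: inseg; lra.
  have jn1 : (n <= j.+1)%N by lia.
  have jm1 : (N.+1 - j.+1 <= m)%N by lia.
  have uh : 0 <= u <= h by lra.
  have := IH j.+1 jn1 jm1 u uh.
  have := Rmult_le_compat_r _ _ _ (Rlt_le _ _ (exp_pos (/ cost N * u))) slope.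
  by rewrite /Rabs; case: Rcase_abs; case: sg1 => ->; case: s1 => ->; lra.
have := signed 1 (or_introl erefl); have := signed (- 1) (or_intror erefl).
by rewrite /Rabs; case: Rcase_abs; lra.
Qed.

(* With [u := N + 1 - v], the smallness [exp (- u)] buys the travel distance [a]:
   losing one unit of [u] between [N] and [N + 1] takes a distance of at least [cost N]. *)
Definition budget (n : nat) (x a : R) : Prop :=
  exists (N : nat) (v : R), [/\ 0 <= v <= 1, a <= sum_f_R0 cost N - v * cost N
    & small_jet n x (exp (v - INR N.+1))].

Lemma budget_nonpos (n : nat) (x a : R) : 0 <= x <= d -> a <= 0 -> budget n x a.
Proof.
(* With N = 0 and v = 1 the required smallness is exp 0 = 1 and the distance bought is 0. *)
move=> xd a0; exists 0%N, 1; split; [lra | by rewrite /=; lra |].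
apply: small_jet_trivial => //; apply: exp_le_compat; rewrite /=.
have := pos_INR n; lra.
Qed.

Lemma budget_le (n : nat) (x a a' : R) : a' <= a -> budget n x a -> budget n x a'.
Proof. by move=> aa' [N [v [v01 ale sj]]]; exists N, v; split => //; lra. Qed.

(** Travelling h at level N raises v by h / [cost N]. Once v reaches 1, the state is that of level N
    - 1 with v = 0, and the rest of the path is handled by induction on N. *)
Lemma budget_move_dir (n : nat) (x s h a : R) :
  s = 1 \/ s = - 1 -> 0 <= h -> 0 <= x <= d -> 0 <= x + s * h <= d ->
  budget n x a -> budget n (x + s * h) (a - h).
Proof.
move=> s1 h0 xd xhd [N [v [v01 ale sj]]].
elim: N => [|N IH] in x h a v h0 xd xhd v01 ale sj *; last first.
  have cN := cost_gt0 N.+1.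
  case: (Rle_dec h ((1 - v) * cost N.+1)) => hc; last first.
    set h1 := (1 - v) * cost N.+1 in hc.
    have h10 : 0 <= h1 by apply: Rmult_le_pos; lra.
    have xd1 : 0 <= x + s * h1 <= d by case: s1 xhd => ->; lra.
    have -> : x + s * h = (x + s * h1) + s * (h - h1) by ring.
    have -> : a - h = (a - h1) - (h - h1) by ring.
    apply: (IH _ _ _ 0) => //; try lra.
    - by move: ale; rewrite /h1 /=; lra.
    have := small_jet_move n N.+1 x s h1 _ s1 h10 xd xd1 _ sj.
    have -> : exp (v - INR N.+2) * exp (/ cost N.+1 * h1) = exp (0 - INR N.+1).
      rewrite -exp_plus; congr exp; rewrite /h1 (S_INR N.+1); field; lra.
    by apply; apply: exp_le_compat; lra.
  exists N.+1, (v + / cost N.+1 * h).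
  have E : / cost N.+1 * h * cost N.+1 = h by field; lra.
  have p0 : 0 <= / cost N.+1 * h.
    by apply: Rmult_le_pos => //; apply: Rlt_le; apply: Rinv_0_lt_compat.
  split; [|by lra|].
    by split; [lra|]; apply: (Rmult_le_reg_r (cost N.+1)) => //; lra.
  have := small_jet_move n N.+1 x s h _ s1 h0 xd xhd _ sj.
  rewrite -exp_plus.
  have -> : v - INR N.+2 + / cost N.+1 * h = v + / cost N.+1 * h - INR N.+2 by ring.
  by apply; apply: exp_le_compat; lra.
have cN := cost_gt0 0.
case: (Rle_dec h ((1 - v) * cost 0)) => hc; last first.
  (* The path exceeds all that level 0 can pay for, so a - h <= 0. *)
  by apply: budget_nonpos => //; move: ale => /=; lra.
exists 0%N, (v + / cost 0 * h).
have E : / cost 0 * h * cost 0 = h by field; lra.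
have p0 : 0 <= / cost 0 * h.
  by apply: Rmult_le_pos => //; apply: Rlt_le; apply: Rinv_0_lt_compat.
split; [|by lra|].
  by split; [lra|]; apply: (Rmult_le_reg_r (cost 0)) => //; lra.
have := small_jet_move n 0 x s h _ s1 h0 xd xhd _ sj.
rewrite -exp_plus.
have -> : v - INR 1 + / cost 0 * h = v + / cost 0 * h - INR 1 by ring.
by apply; apply: exp_le_compat; lra.
Qed.

Lemma budget_move (n : nat) (x y a : R) :
  0 <= x <= d -> 0 <= y <= d -> budget n x a -> budget n y (a - Rabs (y - x)).
Proof.
move=> xd yd bx; case: (Rle_dec x y) => xy.
  rewrite Rabs_pos_eq; last by lra.
  have E : y = x + 1 * (y - x) by ring.
  by rewrite {1}E; apply: budget_move_dir => //; [left|lra|lra].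
rewrite -Rabs_Ropp Rabs_pos_eq; last by lra.
have E : y = x + - 1 * - (y - x) by ring.
rewrite {1}E; apply: budget_move_dir => //; [by right|lra|lra].
Qed.

Hypothesis g_pos0 : forall n, 0 < g n 0.

Lemma g_continuity (n : nat) (t : R) : 0 <= t <= d -> continuity_pt (g n) t.
Proof.
move=> td; apply: derivable_continuous_pt; exists (g n.+1 t); exact: g_derive.
Qed.

Lemma zero_of_neg (n : nat) (z : R) :
  0 < z <= d -> g n z < 0 -> exists2 y, 0 < y < z & g n y = 0.
Proof.
move=> zd gz; have g0 := g_pos0 n.
have cont a : 0 <= a <= z -> continuity_pt (- g n)%F a.
  by move=> az; apply: continuity_pt_opp; apply: g_continuity; lra.
have [||| y [y0z gy]] := IVT_interv (- g n)%F 0 z cont.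
- lra.
- by rewrite /opp_fct; lra.
- by rewrite /opp_fct; lra.
have {}gy : g n y = 0 by move: gy; rewrite /opp_fct; lra.
exists y => //; split.
  by case: (Req_dec y 0) => [y0|]; [move: gy g0; rewrite y0; lra | lra].
by case: (Req_dec y z) => [yz|]; [move: gy gz; rewrite yz; lra | lra].
Qed.

(** The drop from [g n 0 > 0] to 0 forces a negative value of [g n.+1], which is positive at 0 and
    hence vanishes in between. *)
Lemma zero_next (n : nat) (z : R) :
  0 < z <= d -> g n z = 0 -> exists2 y, 0 < y < z & g n.+1 y = 0.
Proof.
move=> zd gz; have g0 := g_pos0 n.
have dg c : 0 <= c <= z -> derivable_pt_lim (g n) c (g n.+1 c).
  by move=> cz; apply: g_derive; lra.
have [c [E cz]] := MVT_cor2 (g n) (g n.+1) 0 z (proj1 zd) dg.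
have gc : g n.+1 c < 0.
  apply: Rnot_le_lt => gc.
  have : 0 <= g n.+1 c * (z - 0) by apply: Rmult_le_pos; lra.
  lra.
have cd : 0 < c <= d by lra.
by have [y yc gy] := zero_of_neg n.+1 c cd gc; exists y => //; lra.
Qed.

(* Travel up through zeros [y_K < ... < y_n = z] of [g K, ..., g n]: at each of them
   the jet gains one order for free, and the total distance is at most [z]. *)
Lemma budget_at_zero (K m n : nat) (z : R) :
  (K.+1 <= n + m)%N -> 0 < z <= d -> g n z = 0 ->
  budget n z (sum_f_R0 cost K - z).
Proof.
elim: m n z => [|m IH] n z Kn zd gz.
  apply: (@budget_le _ _ (sum_f_R0 cost K)); first by lra.
  (* Here n >= K + 1, so the trivial bound exp (- n) already suffices. *)
  exists K, 0; split; [lra | lra |].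
  apply: small_jet_trivial; first by lra.
  by apply: exp_le_compat; have : INR K.+1 <= INR n by [apply: le_INR; lia]; lra.
have [y yz gy] := zero_next n z zd gz.
have Kn1 : (K.+1 <= n.+1 + m)%N by lia.
have yd : 0 < y <= d by lra.
have y0 : 0 <= y <= d by lra.
have z0 : 0 <= z <= d by lra.
have := budget_move n.+1 y z _ y0 z0 (IH n.+1 y Kn1 yd gy).
rewrite Rabs_pos_eq; last by lra.
have -> : sum_f_R0 cost K - y - (z - y) = sum_f_R0 cost K - z by ring.
move=> [N [v [v01 ale sj]]]; exists N, v; split => // j.
rewrite leq_eqVlt => /orP [/eqP <-|]; last exact: sj.
rewrite gz Rabs_R0; apply: Rmult_le_pos; first by apply: Rlt_le; exact: exp_pos.
by apply: Rmult_le_pos; apply: Rlt_le; [exact: exp_pos | exact: L_gt0].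
Qed.

Hypothesis cost_diverges : forall B, exists n, B < sum_f_R0 cost n.

Lemma sum_cost_mono (n p : nat) : (n <= p)%N -> sum_f_R0 cost n <= sum_f_R0 cost p.
Proof.
elim: p => [|p IH]; first by rewrite leqn0 => /eqP ->; lra.
rewrite leq_eqVlt => /orP [/eqP ->|]; first by lra.
by rewrite ltnS => /IH /=; have := cost_gt0 p.+1; lra.
Qed.

Theorem derivatives_nonneg (n : nat) (t : R) : 0 <= t <= d -> 0 <= g n t.
Proof.
move=> td; apply: Rnot_lt_le => gt.
have g0 := g_pos0 n.
have t0 : 0 < t <= d by case: (Req_dec t 0) => [E|]; [move: gt; rewrite E; lra|lra].
have [z zt gz] := zero_of_neg n t t0 gt.
have zd : 0 < z <= d by lra.
set w := exp (INR n) * L n.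
have w0 : 0 < w by apply: Rmult_lt_0_compat; [exact: exp_pos | exact: L_gt0].
(* N0 is chosen so that every N >= N0 gives exp N > w / [g n 0]. *)
have [N0 HN0] := INR_unbounded (w / g n 0).
(* The term 2 z pays for the climb to z and for the return to 0; what remains exceeds the total cost
   up to N0 and so forces N > N0. *)
have [K HK] := cost_diverges (sum_f_R0 cost N0 + 2 * z).
have z0 : 0 <= z <= d by lra.
have d0 : 0 <= 0 <= d by lra.
have := budget_move n z 0 _ z0 d0 (budget_at_zero K K.+1 n z (leq_addl _ _) zd gz).
rewrite -Rabs_Ropp Rabs_pos_eq; last by lra.
move=> [N [v [v01 ale sj]]].
have {sj} : g n 0 <= exp (- INR N) * w.
  apply: Rle_trans (Rle_abs _) _; apply: Rle_trans (sj n (leqnn n)) _.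
  rewrite -/w; apply: Rmult_le_compat_r; first by lra.
  by apply: exp_le_compat; rewrite S_INR; lra.
have [NN0|N0N] := leqP N N0.
  have cN := cost_gt0 N; have := sum_cost_mono _ _ NN0.
  have : 0 <= v * cost N by apply: Rmult_le_pos; lra.
  lra.
have {}N0N : INR N0 <= INR N by apply: le_INR; lia.
have eN := exp_ineq1_le (INR N).
rewrite exp_Ropp => Hg.
have : g n 0 * exp (INR N) <= w.
  have e0 := exp_pos (INR N).
  apply: (Rle_trans _ (/ exp (INR N) * w * exp (INR N))).
    by apply: Rmult_le_compat_r; lra.
  by apply: Req_le; field; lra.
have : w < g n 0 * exp (INR N).
  apply: (Rle_lt_trans _ (g n 0 * (w / g n 0))); first by apply: Req_le; field; lra.
  by apply: Rmult_lt_compat_l; lra.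
lra.
Qed.

(** Induction on n: the bound for [g m.+1] is integrated from 0, where [g m] is positive. The base
    case is monotonicity of [g m]. *)
Lemma taylor_term_le (n m : nat) (x : R) :
  0 <= x <= d -> g (m + n)%N 0 * (x ^ n / INR (n`!)%N) <= g m x.
Proof.
elim: n m x => [|n IH] m x xd.
  rewrite addn0 fact0 /= Rdiv_1_r Rmult_1_r.
  apply: (nondecreasing_of_derive (g m) (g m.+1)); first by lra.
    by move=> t tx; apply: g_derive; lra.
  by move=> t tx; apply: derivatives_nonneg; lra.
set A := g (m + n.+1)%N 0.
have f0 k : INR (k`!)%N <> 0 by apply: not_0_INR; have := fact_gt0 k; lia.
have D t : 0 <= t <= x ->
    derivable_pt_lim (fun u => g m u - A / INR ((n.+1)`!)%N * u ^ n.+1) t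
      (g m.+1 t - A / INR ((n.+1)`!)%N * (INR n.+1 * t ^ n)).
  move=> tx; apply: derivable_pt_lim_minus; first by apply: g_derive; lra.
  by apply: derivable_pt_lim_scal; exact: (derivable_pt_lim_pow t n.+1).
have := nondecreasing_of_derive _ _ 0 x (proj1 xd) D.
rewrite pow_i; last by lia.
move=> H; have gm := g_pos0 m.
suff : g m 0 - A / INR ((n.+1)`!)%N * 0 <= g m x - A / INR ((n.+1)`!)%N * x ^ n.+1.
  by rewrite /Rdiv => ?; lra.
apply: H => t tx; have td : 0 <= t <= d by lra.
have := IH m.+1 t td; rewrite addSnnS -/A => {}IH.
suff -> : A / INR ((n.+1)`!)%N * (INR n.+1 * t ^ n) = A * (t ^ n / INR (n`!)%N) by lra.
rewrite factS mult_INR; field; split => //.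
by apply: not_0_INR.
Qed.

End Bang.

(** * Restriction to a coordinate axis *)

Definition on_axis (r : nat) (i : 'I_r) (n : nat) : mindex r :=
  fun j => if j == i then n else 0%N.

Lemma mlen_on_axis (r : nat) (i : 'I_r) (n : nat) : mlen r (on_axis r i n) = n.
Proof.
rewrite /mlen (bigD1 i) //= big1 /on_axis ?eqxx ?addn0 // => j /negbTE ji.
by rewrite ji.
Qed.

Lemma mincr_on_axis (r : nat) (i : 'I_r) (n : nat) :
  mincr r (on_axis r i n) i = on_axis r i n.+1.
Proof.
by apply: functional_extensionality => j; rewrite /mincr /on_axis; case: eqP.
Qed.

Lemma pupd_pupd (r : nat) (x : pt r) (i : 'I_r) (s t : R) :
  pupd r (pupd r x i s) i t = pupd r x i t.
Proof.
by apply: functional_extensionality => j; rewrite /pupd; case: eqP.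
Qed.

(** Heine-Borel by suprema: [E] collects the t for which the segment up to t has a finite subcover,
    and its supremum m is shown to be d. *)
Lemma compact_axis_segment (r : nat) (i : 'I_r) (d : R) : 0 <= d ->
  compact_set r (fun x => exists2 t, 0 <= t <= d & x = pupd r (pzero r) i t).
Proof.
move=> d0 I O Oopen Ocov; pose p := pupd r (pzero r) i.
pose E t := 0 <= t <= d /\
  exists l, forall s, 0 <= s <= t -> exists k, In k l /\ O k (p s).
have E0 : E 0.
  split; first by lra.
  have [|k Ok] := Ocov (p 0); first by exists 0 => //; lra.
  exists (k :: nil) => s s0; exists k; split; first by left.
  by have -> : s = 0 by lra.
have [m [mub mlub]] : {m | is_lub E m}.
  apply: completeness; last by exists 0.
  by exists d => t [? _]; lra.
have md : 0 <= m <= d by split; [exact: mub | apply: mlub => t [? _]; lra].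
have [|k Ok] := Ocov (p m); first by exists m.
have [e [e0 Oe]] := Oopen k _ Ok.
have Onear s : Rabs (s - m) < e -> O k (p s).
  move=> sm; apply: Oe => j; rewrite /p /pupd; case: (j == i) => //.
  by rewrite Rminus_diag Rabs_R0.
have [t [Et mt]] : exists t, E t /\ m - e < t.
  apply: NNPP => H; have : m <= m - e.
    apply: mlub => t Et; apply: Rnot_lt_le => mt; apply: H; by exists t.
  lra.
have [td [l Hl]] := Et.
(* Adding the open set around m to a subcover reaching past m - e extends the covered segment beyond
   m, unless d is met first. *)
have E' : E (Rmin (m + e / 2) d).
  split; first by split; [apply: Rmin_glb; lra | exact: Rmin_r].
  exists (k :: l) => s [s0 sm]; have s1 := Rmin_l (m + e / 2) d.
  case: (Rle_dec s t) => st.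
    by have [k' [lk' Ok']] := Hl s (conj s0 st); exists k'; split; [right|].
  exists k; split; first by left.
  by apply: Onear; apply: Rabs_def1; lra.
have le_m := mub _ E'.
have Ed : E d by move: le_m E'; rewrite /Rmin; case: Rle_dec => // *; lra.
have [_ [l' Hl']] := Ed.
by exists l' => x [s sd ->]; exact: Hl'.
Qed.

(** Bang's argument applies to the pure derivatives in direction i; the Taylor terms of f at 0 are
    then all at most f at distance d along the axis. *)
Lemma jet_axis_bound (r : nat) (i : 'I_r) (M : nat -> R) (b : mindex r -> R) :
  weight_sequence M -> quasianalytic M -> in_jet_image true r M b ->
  (forall n, 0 < b (on_axis r i n)) ->
  exists x G, 0 < x /\ forall n, b (on_axis r i n) * x ^ n <= G.
Proof.
move=> [M0 [_ [_ [Mlc _]]]] Mqa [k [f [D [[[_ [_ Dd]] Dcl] bE]]]] bpos.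
(* Half the side parameter keeps the closed segment inside the open cube. *)
pose d := / INR k.+1 / 2; pose p := pupd r (pzero r) i.
have k0 : 0 < / INR k.+1 by apply: Rinv_0_lt_compat; apply: lt_0_INR; lia.
have d0 : 0 < d by rewrite /d; lra.
have p_cube t : 0 <= t <= d -> cube r k (p t).
  move=> td j; rewrite /p /pupd; case: (j == i).
    by rewrite Rabs_pos_eq; move: td; rewrite /d; lra.
  by rewrite /pzero Rabs_R0.
have [|h [h0 [C HC]]] := Dcl _ (compact_axis_segment r i d (Rlt_le _ _ d0)).
  by move=> x [t td ->]; exact: p_cube.
(* C may be zero or negative; [Rabs C + 1] makes [L] positive. *)
pose L n := (Rabs C + 1) * (h ^ n * M n).
pose g n t := D (on_axis r i n) (p t).
have C1 : 0 < Rabs C + 1 by have := Rabs_pos C; lra.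
have hM n : 0 < h ^ n * M n by apply: Rmult_lt_0_compat => //; exact: pow_lt.
have L_gt0 n : 0 < L n by apply: Rmult_lt_0_compat.
have L_lc n : L n.+1 ^ 2 <= L n * L n.+2.
  have := Mlc n.+1 isT; rewrite subn1 addn1 [n.+1.-1]/= => lc.
  have -> : L n.+1 ^ 2 = ((Rabs C + 1) * h ^ n.+1) ^ 2 * M n.+1 ^ 2 by rewrite /L; ring.
  have -> : L n * L n.+2 = ((Rabs C + 1) * h ^ n.+1) ^ 2 * (M n * M n.+2).
    by rewrite /L -!tech_pow_Rmult; ring.
  by apply: Rmult_le_compat_l => //; apply: pow2_ge_0.
have g_derive n t : 0 <= t <= d -> derivable_pt_lim (g n) t (g n.+1 t).
  move=> td; have := Dd (on_axis r i n) i _ (p_cube t td).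
  rewrite mincr_on_axis (_ : p t i = t); last by rewrite /p /pupd eqxx.
  apply: derivable_pt_lim_ext => u; by rewrite /g /p pupd_pupd.
have g_bound n t : 0 <= t <= d -> Rabs (g n t) <= L n.
  move=> td.
  have pK : exists2 s, 0 <= s <= d & p t = pupd r (pzero r) i s by exists t.
  have := HC (on_axis r i n) (p t) pK; rewrite mlen_on_axis -/(g n t) /L => Hn.
  apply: Rle_trans Hn _; apply: Rmult_le_compat_r; first by apply: Rlt_le.
  by have := Rle_abs C; lra.
have p0 : p 0 = pzero r.
  by apply: functional_extensionality => j; rewrite /p /pupd; case: (j == i).
have f0 n : 0 < INR (n`!)%N by apply: lt_0_INR; have := fact_gt0 n; lia.
have g0E n : g n 0 = b (on_axis r i n) * INR (n`!)%N.
  by rewrite bE /jet mlen_on_axis /g p0; field; have := f0 n; lra.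
have g_pos0 n : 0 < g n 0 by rewrite g0E; apply: Rmult_lt_0_compat.
have eh : 0 < exp 1 * h by apply: Rmult_lt_0_compat => //; exact: exp_pos.
have cost_div B : exists n, B < sum_f_R0 (cost L) n.
  (* [cost L q] equals M_q / M_{q+1} divided by e h, hence the rescaled bound. *)
  have [n Hn] := Mqa (B * (exp 1 * h)); exists n.
  rewrite (PartSum.sum_eq _ (fun q => M q / M (q + 1)%N * / (exp 1 * h))); last first.
    move=> q _; rewrite /cost /L addn1 -tech_pow_Rmult.
    have := pow_lt h q h0; have := M0 q; have := M0 q.+1; have := exp_pos 1 => *.
    by field; lra.
  rewrite -scal_sum; apply: (Rmult_lt_reg_l (exp 1 * h)) => //.
  by rewrite -Rmult_assoc Rinv_r; lra.
exists d, (g 0%N d); split=> // n.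
have dd : 0 <= d <= d by lra.
have := taylor_term_le L g d L_gt0 L_lc g_derive g_bound g_pos0 cost_div n 0 d dd.
rewrite add0n g0E; apply: Rle_trans; apply: Req_le; field; have := f0 n; lra.
Qed.

(** * The witness sequence and the conclusion *)

Lemma in_jet_image_Beurling_Roumieu (r : nat) (M : nat -> R) (b : mindex r -> R) :
  in_jet_image false r M b -> in_jet_image true r M b.
Proof.
move=> [k [f [D [[Dd Dcl] bE]]]]; exists k, f, D; split=> //; split=> // K cK KU.
by exists 1; split; [exact: Rlt_0_1 | apply: Dcl => //; exact: Rlt_0_1].
Qed.

Lemma mseq_gt0 (N : nat -> R) (p : nat) : weight_sequence N -> 0 < mseq N p.
Proof.
move=> [N0 _]; apply: Rdiv_lt_0_compat => //; apply: lt_0_INR.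
by have := fact_gt0 p; lia.
Qed.

Lemma pow_le_mseq (N : nat -> R) (B : R) (p : nat) :
  weight_sequence N -> (1 <= p)%N -> 0 <= B -> B <= root_m N p -> B ^ p <= mseq N p.
Proof.
move=> wN p1 B0 BN; have m0 := mseq_gt0 N p wN.
have p0 : 0 < INR p by apply: lt_0_INR; lia.
have -> : mseq N p = root_m N p ^ p.
  rewrite /root_m -Rpower_pow; last exact: exp_pos.
  by rewrite Rpower_mult Rinv_l ?Rpower_1 //; lra.
exact: pow_incr.
Qed.

(** Absorbs finitely many orders into the constant; 1 <= C lets the same constant serve the tail. *)
Lemma finite_ratio_bound (u v : nat -> R) (P : nat) :
  (forall p, 0 < v p) -> exists C, 1 <= C /\ forall p, (p < P)%N -> u p <= C * v p.
Proof.
move=> v0; elim: P => [|P [C [C1 HC]]]; first by exists 1; split; [lra|].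
exists (Rmax C (u P / v P)).
have Cl := Rmax_l C (u P / v P); have Cr := Rmax_r C (u P / v P).
split; first by lra.
move=> p; rewrite ltnS leq_eqVlt => /orP [/eqP ->|pP].
  have E : u P = u P / v P * v P by field; have := v0 P; lra.
  by rewrite {1}E; apply: Rmult_le_compat_r => //; apply: Rlt_le.
by apply: Rle_trans (HC p pP) _; apply: Rmult_le_compat_r => //; apply: Rlt_le.
Qed.

Definition sqrt_seq (r : nat) (N : nat -> R) : mindex r -> R :=
  fun a => sqrt (mseq N (mlen r a)).

(** If n_p >= h^(-2p), then h^p sqrt n_p >= 1, and multiplying by sqrt n_p gives sqrt n_p <= h^p
    n_p. *)
Lemma seqnorm_finite_sqrt (r : nat) (N : nat -> R) (h : R) (P : nat) :
  weight_sequence N -> 0 < h ->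
  (forall p, (P <= p)%N -> (1 <= p)%N -> (/ h) ^ 2 <= root_m N p) ->
  seqnorm_finite r N h (sqrt_seq r N).
Proof.
move=> wN h0 HP.
have m0 p := mseq_gt0 N p wN.
have hp p : 0 < h ^ p by exact: pow_lt.
have v0 p : 0 < h ^ p * mseq N p by apply: Rmult_lt_0_compat.
(* The cut at [P.+1] puts order 0, which has no p-th root, among the finitely many exceptions. *)
have [C [C1 HC]] := finite_ratio_bound (fun p => sqrt (mseq N p)) _ P.+1 v0.
exists C => a; rewrite /sqrt_seq Rabs_pos_eq; last exact: sqrt_pos.
move: (mlen r a) => p.
have [/HC //|Pp] := ltnP p P.+1.
have P1 : (P <= p)%N by lia.
have p1 : (1 <= p)%N by lia.
have hi : 0 < / h by exact: Rinv_0_lt_compat.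
have := pow_le_mseq N _ p wN p1 (pow2_ge_0 _) (HP p P1 p1).
rewrite -pow_mult Nat.mul_comm pow_mult => le_m.
have le_s : (/ h) ^ p <= sqrt (mseq N p).
  rewrite -(sqrt_pow2 ((/ h) ^ p)); last by apply: Rlt_le; exact: pow_lt.
  exact: sqrt_le_1_alt.
have one_le : 1 <= h ^ p * sqrt (mseq N p).
  have -> : 1 = h ^ p * (/ h) ^ p by rewrite -Rpow_mult_distr Rinv_r ?pow1; lra.
  by apply: Rmult_le_compat_l => //; apply: Rlt_le.
apply: (Rle_trans _ (1 * (h ^ p * mseq N p))); last first.
  by apply: Rmult_le_compat_r => //; apply: Rlt_le.
rewrite -{2}(sqrt_sqrt (mseq N p)); last by apply: Rlt_le.
have := sqrt_pos (mseq N p); nra.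
Qed.

Lemma in_Lambda_sqrt (c : bool) (r : nat) (N : nat -> R) :
  weight_sequence N -> growth c N -> in_Lambda c r N (sqrt_seq r N).
Proof.
move=> wN; case: c => gN.
  have [_ [_ [_ [_ [c [c0 [P HP]]]]]]] := wN.
  have s0 := sqrt_lt_R0 c c0.
  (* This h satisfies h^(-2) = c, the lower bound from the liminf condition. *)
  exists (/ sqrt c); split; first exact: Rinv_0_lt_compat.
  apply: (seqnorm_finite_sqrt _ _ _ P) => //; first exact: Rinv_0_lt_compat.
  by move=> p Pp p1; rewrite Rinv_inv pow2_sqrt; [exact: HP | lra].
move=> h h0; have [P HP] := gN ((/ h) ^ 2).
by apply: (seqnorm_finite_sqrt _ _ _ P) => // p Pp p1; apply: Rlt_le; exact: HP.
Qed.

Lemma growth_root (c : bool) (N : nat -> R) (B : R) :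
  growth c N -> exists2 k, (1 <= k)%N & B < root_m N k.
Proof.
case: c => gN; first by have [k [k1 Bk]] := gN B; exists k.
by have [K HK] := gN B; exists K.+1 => //; apply: HK.
Qed.

(** A jet would satisfy sqrt n_k x^k <= G for all k, while growth gives some k >= 1 with sqrt n_k >=
    q^k. *)
Lemma sqrt_seq_not_jet (c : bool) (r : nat) (M N : nat -> R) : (0 < r)%N ->
  weight_sequence M -> quasianalytic M -> weight_sequence N -> growth c N ->
  ~ in_jet_image true r M (sqrt_seq r N).
Proof.
move=> r0 wM qM wN gN jN; have m0 p := mseq_gt0 N p wN.
have bE n : sqrt_seq r N (on_axis r (Ordinal r0) n) = sqrt (mseq N n).
  by rewrite /sqrt_seq mlen_on_axis.
have [|x [G [x0 HG]]] := jet_axis_bound r (Ordinal r0) M _ wM qM jN.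
  by move=> n; rewrite bE; exact: sqrt_lt_R0.
have G0 : 0 < G.
  apply: Rlt_le_trans (HG 0%N); rewrite bE Rmult_1_r; exact: sqrt_lt_R0.
(* Chosen so that (q x)^k = (G + 1)^k >= G + 1 > G. *)
pose q := (G + 1) / x.
have q0 : 0 < q by apply: Rdiv_lt_0_compat; lra.
have [k k1 /Rlt_le Bk] := growth_root c N (q ^ 2) gN.
have := pow_le_mseq N _ k wN k1 (pow2_ge_0 _) Bk.
rewrite -pow_mult Nat.mul_comm pow_mult => le_m.
have le_s : q ^ k <= sqrt (mseq N k).
  rewrite -(sqrt_pow2 (q ^ k)); last by apply: Rlt_le; exact: pow_lt.
  exact: sqrt_le_1_alt.
have := HG k; rewrite bE => le_G.
have : q ^ k * x ^ k <= G.
  apply: Rle_trans le_G; apply: Rmult_le_compat_r => //.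
  by apply: Rlt_le; exact: pow_lt.
rewrite -Rpow_mult_distr (_ : q * x = G + 1); last by rewrite /q; field; lra.
have : (G + 1) ^ 1 <= (G + 1) ^ k by apply: Rle_pow; [lra | lia].
rewrite pow_1; lra.
Qed.

(* c = true: Roumieu case [N] = {N};  c = false: Beurling case [N] = (N).
   For each case: j^oo(E_{M}) ∩ Λ_[N] ⊊ Λ_[N], hence also
   j^oo(E_(M)) ∩ Λ_[N] ⊊ Λ_[N], and the Borel map E_[N] -> Λ_[N] is not onto. *)
Theorem mainTheorem3 (r : nat) (Hr : (0 < r)%N) (M N : nat -> R) :
  weight_sequence M -> weight_sequence N ->
  quasianalytic M -> quasianalytic N ->
  forall c : bool, growth c N ->
    (exists b, in_Lambda c r N b /\ ~ in_jet_image true r M b) /\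
    (exists b, in_Lambda c r N b /\ ~ in_jet_image false r M b) /\
    (exists b, in_Lambda c r N b /\ ~ in_jet_image c r N b).
Proof.
move=> wM wN qM qN c gN.
have inL := in_Lambda_sqrt c r N wN gN.
have notM := sqrt_seq_not_jet c r M N Hr wM qM wN gN.
have notN := sqrt_seq_not_jet c r N N Hr wN qN wN gN.
split; [|split]; exists (sqrt_seq r N); split=> //.
  by move/in_jet_image_Beurling_Roumieu.
by case: c {gN inL} => // /in_jet_image_Beurling_Roumieu.
Qed.
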